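(* Let $X=\{x\in\mathbb R^n_+\mid Bx\le b\}$ be a polytope with extreme points $v^1,\dots,v^m$, let $g$ be a continuous convex real function on $[y^{\mathrm{lo}},y^{\mathrm{up}}]\subset\mathbb R$ with $y^{\mathrm{lo}}<y^{\mathrm{up}}$, let $\mathcal D=X\times[y^{\mathrm{lo}},y^{\mathrm{up}}]\times\mathbb R^{n+n}$, and let $$S=\{\pi=(x,y,z,\underline{xy})\in\mathcal D\mid z_j=x_j\,g(y),\ \underline{xy}_j=x_j\,y,\ j=1,\dots,n\}.$$ Then $\operatorname{Conv}(S)$ is the projection onto the space of $\pi=(x,y,z,\underline{xy})$ of the set of all $(\pi,y^1,\dots,y^m,w^1,\dots,w^m,w,\lambda^1,\dots,\lambda^m)$ satisfying $$\begin{aligned} &w^i\ge g^*(\lambda^i,y^i), && i=1,\dots,m,\\ &w^i\le\lambda^ig(y^{\mathrm{lo}})+\Bigl(\frac{g(y^{\mathrm{up}})-g(y^{\mathrm{lo}})}{y^{\mathrm{up}}-y^{\mathrm{lo}}}\Bigr)(y^i-\lambda^iy^{\mathrm{lo}}), && i=1,\dots,m,\\ &\lambda^iy^{\mathrm{lo}}\le y^i\le\lambda^iy^{\mathrm{up}}, && i=1,\dots,m,\\ &z=\sum_{i=1}^mv^iw^i,\quad \underline{xy}=\sum_{i=1}^mv^iy^i,\quad w=\sum_{i=1}^mw^i,\\ &y=\sum_{i=1}^my^i,\quad x=\sum_{i=1}^m\lambda^iv^i,\quad(\lambda^1,\dots,\lambda^m)\in\Delta^m. \end{aligned}$$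
   Context: $\operatorname{Conv}$ denotes convex hull. $\underline{xy}\in\mathbb R^n$ is a vector variable with components $\underline{xy}_j$. The $y^i,w^i,w,\lambda^i$ are real scalars and the superscripts are indices. $\Delta^m=\{(\lambda^1,\dots,\lambda^m)\in\mathbb R^m_+\mid\sum_{i=1}^m\lambda^i=1\}$. The positively homogeneous function $g^*$ associated with $g:[y^{\mathrm{lo}},y^{\mathrm{up}}]\to\mathbb R$ is $g^*(\lambda,y)=\lambda\,g(\lambda^{-1}y)$ if $\lambda>0$ and $\lambda^{-1}y\in[y^{\mathrm{lo}},y^{\mathrm{up}}]$, and $g^*(0,0)=0$. *)

(* Defs.v *)
From HB Require Import structures.
From mathcomp Require Import all_boot all_order all_algebra.
From mathcomp Require Import all_classical all_reals all_analysis.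

Set Implicit Arguments.
Unset Strict Implicit.
Unset Printing Implicit Defensive.

Import Order.TTheory GRing.Theory Num.Theory.
Import numFieldNormedType.Exports.

Local Open Scope classical_set_scope.
Local Open Scope ring_scope.

Definition Conv (R : realType) (V : lmodType R) (A : set V) : set V :=
  [set p | forall C : set V, @convex_set R V C -> A `<=` C -> C p].

Definition extreme_points (R : realType) (V : lmodType R) (A : set V) : set V :=
  [set x | A x /\
     forall (u v : V) (t : R), A u -> A v -> 0 < t < 1 ->
       x = t *: u + (1 - t) *: v -> u = x /\ v = x].

Definition nonneg_polyhedron (R : realType) (p n : nat)
    (B : 'M[R]_(p, n)) (b : 'cV[R]_p) : set 'cV[R]_n :=
  [set x : 'cV[R]_n | (forall j, 0 <= x j 0) /\ (forall k, (B *m x) k 0 <= b k 0)].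

Definition simplex (R : realType) (m : nat) : set ('I_m -> R) :=
  [set l : 'I_m -> R | (forall i, 0 <= l i) /\ \sum_(i < m) l i = 1].

(* [g^*] is a partial function.  It takes the value [+oo] off its domain, so
   that an inequality [g^*(l, y) <= w] with [w] real forces [(l, y)] to lie in
   the domain. *)
Definition gstar (R : realType) (ylo yup : R) (g : R -> R) (l y : R) : \bar R :=
  if (0 < l) && (l^-1 * y \in `[ylo, yup]) then (l * g (l^-1 * y))%:E
  else if (l == 0) && (y == 0) then 0%:E
  else +oo%E.

(* The space of [pi = (x, y, z, xy)].  The type [R^o] is [R] as a module over
   itself. *)
Definition pi_space (R : realType) (n : nat) : lmodType R :=
  ('cV[R]_n * R^o * 'cV[R]_n * 'cV[R]_n)%type.

Definition domainD (R : realType) (n : nat) (X : set 'cV[R]_n) (ylo yup : R) :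
    set (pi_space R n) :=
  X `*` `[ylo, yup] `*` setT `*` setT.

Definition setS (R : realType) (n : nat) (X : set 'cV[R]_n) (ylo yup : R)
    (g : R -> R) : set (pi_space R n) :=
  [set pi | domainD X ylo yup pi /\
    let: (x, y, z, xy) := pi in
    forall j, z j 0 = x j 0 * g y /\ xy j 0 = x j 0 * y].

(* Here [yi], [wi], [lam] are the families [y^i], [w^i], [lambda^i]. *)
Definition lifted_set (R : realType) (n m : nat) (v : 'I_m -> 'cV[R]_n)
    (ylo yup : R) (g : R -> R) :
    set (pi_space R n * (('I_m -> R) * ('I_m -> R) * R * ('I_m -> R))) :=
  [set q |
    let: ((x, y, z, xy), (yi, wi, w, lam)) := q in
    [/\ forall i, (gstar ylo yup g (lam i) (yi i) <= (wi i)%:E)%E,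
        forall i, wi i <= lam i * g ylo
                  + ((g yup - g ylo) / (yup - ylo)) * (yi i - lam i * ylo)
      & forall i, lam i * ylo <= yi i <= lam i * yup] /\
    [/\ z = \sum_(i < m) wi i *: v i,
        xy = \sum_(i < m) yi i *: v i
      & w = \sum_(i < m) wi i] /\
    [/\ y = \sum_(i < m) yi i,
        x = \sum_(i < m) lam i *: v i
      & simplex lam]].

(* Main.v *)
(** For fixed [v^i], the triples [(l, y^i, w^i)] allowed by the lifted
    constraints are exactly [l * (1, t, u)] with [(t, u)] between the graph of
    [g] and its chord, a convex region that is the convex hull of the graph.
    Hence the projection consists of the convex combinations of points
    [q^i = (v^i, t, u v^i, t v^i)], one from each of [m] convex sets.  It is
    therefore convex, and it lies in every convex set containing [S]; it
    contains [S] because every point of the polytope is a convex combination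
    of the [v^i].  The latter is proved by induction on the number of slack
    constraints: a point that is not extreme lies on a segment whose two ends
    have fewer slack constraints. *)
Require Import Defs.
From HB Require Import structures.
From mathcomp Require Import all_boot all_order all_algebra.
From mathcomp Require Import all_classical all_reals all_analysis.
From mathcomp Require Import ring lra.

Import Order.TTheory GRing.Theory Num.Theory.
Import numFieldNormedType.Exports.

Local Open Scope classical_set_scope.
Local Open Scope ring_scope.

Set Implicit Arguments.
Unset Strict Implicit.
Unset Printing Implicit Defensive.

(** * Convex combinations and joins of convex sets *)

Section Convexity.
Context {R : realType}.
Implicit Type V : lmodType R.

Lemma convex_setP V (A : set V) : @convex_set R V A <->
  forall x y t, 0 <= t -> t <= 1 -> A x -> A y -> A (t *: x + (1 - t) *: y).
Proof.
split=> [cA x y t t0 t1 Ax Ay|cA x y t].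
  by have := cA x y (Itv01 t0 t1); rewrite !inE; apply.
by rewrite !inE; apply: cA.
Qed.

(** Addition in the cone over [A]: if [a + b = 0], both weights vanish and any point of [A] serves;
    otherwise normalise by [a + b]. *)
Lemma convex_scale_add V (A : set V) (a b : R) x y :
    @convex_set R V A -> 0 <= a -> 0 <= b -> A x -> A y ->
  exists2 z, A z & a *: x + b *: y = (a + b) *: z.
Proof.
move=> /convex_setP cA a0 b0 Ax Ay; have ab0 := addr_ge0 a0 b0.
have [ab|ab] := eqVneq (a + b) 0.
  have /eqP a00 : a == 0 by rewrite eq_le a0 andbT -ab lerDl.
  have /eqP b00 : b == 0 by rewrite eq_le b0 andbT -ab lerDr.
  by exists x => //; rewrite a00 b00 addr0 !scale0r addr0.
have t1 : a / (a + b) <= 1 by rewrite ler_pdivrMr ?mul1r ?lerDl// lt0r ab.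
exists (a / (a + b) *: x + (1 - a / (a + b)) *: y).
  by apply: cA => //; exact: divr_ge0.
rewrite scalerDr !scalerA mulrBr mulr1 mulrCA divff// mulr1.
by rewrite [a + b]addrC addrK.
Qed.

(** Partial sums of the weights need not be 1, so the induction carries a nonnegative total weight
    times one point of [A]. *)
Lemma convex_combination V (A : set V) m (l : 'I_m -> R) (p : 'I_m -> V) :
    @convex_set R V A -> simplex l -> (forall i, A (p i)) ->
  A (\sum_i l i *: p i).
Proof.
move=> cA [l0 l1] Ap.
case: m l p l0 l1 Ap => [|m] l p l0 l1 Ap.
  by move/eqP: l1; rewrite big_ord0 eq_sym oner_eq0.
suff [z Az ->] : exists2 z, A z & \sum_i l i *: p i = (\sum_i l i) *: z.
  by rewrite l1 scale1r.
suff [] : 0 <= \sum_i l i /\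
    exists2 z, A z & \sum_i l i *: p i = (\sum_i l i) *: z by [].
apply: (big_ind2 (fun q s => 0 <= s /\ exists2 z, A z & q = s *: z)).
- by split=> //; exists (p ord0); rewrite ?scale0r.
- move=> _ s _ t [s0 [x Ax ->]] [t0 [y Ay ->]]; split; first exact: addr_ge0.
  exact: convex_scale_add.
- by move=> i _; split=> //; exists (p i).
Qed.

(** For nonempty convex [Q i] this is the convex hull of their union: one point from each set is
    enough. *)
Definition convex_join V m (Q : 'I_m -> set V) : set V :=
  [set p | exists l q, [/\ simplex l, forall i, Q i (q i)
                         & p = \sum_(i < m) l i *: q i]].

(** The two summands of index [i] merge into a multiple of a single point of [Q i]. *)
Lemma convex_join_convex V m (Q : 'I_m -> set V) :
  (forall i, @convex_set R V (Q i)) -> @convex_set R V (convex_join Q).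
Proof.
move=> cQ; apply/convex_setP.
move=> _ _ t t0 t1 [l [q [[l0 l1] Qq ->]]] [l' [q' [[l0' l1'] Qq' ->]]].
have u0 : 0 <= 1 - t by rewrite subr_ge0.
have /choice[r Qr] i : exists z, Q i z /\
    t *: (l i *: q i) + (1 - t) *: (l' i *: q' i)
    = (t * l i + (1 - t) * l' i) *: z.
  have [z Qz e] := convex_scale_add (cQ i) (mulr_ge0 t0 (l0 i))
    (mulr_ge0 u0 (l0' i)) (Qq i) (Qq' i).
  by exists z; split; rewrite // !scalerA.
exists (fun i => t * l i + (1 - t) * l' i), r; split.
- split=> [i|]; first by rewrite addr_ge0 ?mulr_ge0.
  by rewrite big_split/= -!mulr_sumr l1 l1' !mulr1 addrC subrK.
- by move=> i; case: (Qr i).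
- rewrite !scaler_sumr -big_split/=.
  by apply: eq_bigr => i _; case: (Qr i).
Qed.

Lemma convex_set1 V (x : V) : @convex_set R V [set x].
Proof.
by apply/convex_setP => _ _ t _ _ -> ->; rewrite /= -scalerDl addrC subrK scale1r.
Qed.

End Convexity.

(** * Extreme points of a bounded polyhedron *)

Section Polyhedron.
Context {R : realType} {p n : nat}.
Variables (A : 'M[R]_(p, n)) (c : 'cV[R]_p).

Definition polyhedron : set 'cV[R]_n :=
  [set x | forall k, (A *m x) k 0 <= c k 0].

Definition slack (x : 'cV[R]_n) : {set 'I_p} := [set k | (A *m x) k 0 < c k 0].

Let mulA (x d : 'cV[R]_n) s k :
  (A *m (x + s *: d)) k 0 = (A *m x) k 0 + s * (A *m d) k 0.
Proof. by rewrite mulmxDr -scalemxAr !mxE. Qed.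

Lemma bounded_no_ray (x d : 'cV[R]_n) : bounded_set polyhedron -> d != 0 ->
  ~ (forall t, 0 <= t -> polyhedron (x + t *: d)).
Proof.
move=> /pinfty_ex_gt0[M M0 /= PM] d0 Pd.
have nd : 0 < `|d| by rewrite normr_gt0.
(* At this [t] the displacement has norm [M + |x| + 1], while the bound [M] on the polyhedron allows
   at most [M + |x|]. *)
pose t := (M + `|x| + 1) / `|d|.
have t0 : 0 <= t by rewrite divr_ge0// !addr_ge0// ltW.
have : `|t *: d| <= M + `|x|.
  rewrite -(addKr x (t *: d)) addrC.
  by apply: le_trans (ler_normB _ _) _; rewrite lerD2r; apply/PM/Pd.
rewrite normrZ ger0_norm// divfK ?gt_eqF//.
by rewrite leNgt ltrDl ltr01.
Qed.

(* Walk along [d] until the first slack constraint becomes tight. *)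
Lemma polyhedron_walk (x d : 'cV[R]_n) : bounded_set polyhedron ->
    polyhedron x -> d != 0 ->
    (forall k, k \notin slack x -> (A *m d) k 0 = 0) ->
  exists s, [/\ 0 < s, polyhedron (x + s *: d)
              & (#|slack (x + s *: d)| < #|slack x|)%N].
Proof.
move=> bP Px d0 tight.
(* If no constraint value increased along [d], a whole ray would stay in the polyhedron. *)
have [k0 k0P] : exists k, 0 < (A *m d) k 0.
  apply: contrapT => /forallNP nk; apply: (@bounded_no_ray x d bP d0) => t t0 k.
  rewrite mulA (le_trans _ (Px k))// gerDl mulr_ge0_le0// leNgt.
  exact/negP/nk.
pose step k := (c k 0 - (A *m x) k 0) / (A *m d) k 0.
have [k kP kmin] := @arg_minP _ _ _ k0 (fun k => 0 < (A *m d) k 0) step k0P.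
(* A constraint tight at [x] is constant along [d], so the minimising [k] is slack and its step is
   positive. *)
have kS : (A *m x) k 0 < c k 0.
  have [] := boolP (k \in slack x); first by rewrite inE.
  by move/tight=> e; rewrite e ltxx in kP.
have s0 : 0 < step k by rewrite divr_gt0// subr_gt0.
have Ps : polyhedron (x + step k *: d).
  move=> j; rewrite mulA; have [jP|jN] := ltP 0 ((A *m d) j 0).
    by rewrite -lerBrDl -ler_pdivlMr//; exact: kmin.
  by rewrite (le_trans _ (Px j))// gerDl mulr_ge0_le0// ltW.
exists (step k); split=> //; apply/proper_card/properP; split.
  apply/fintype.subsetP => j; rewrite inE mulA; apply: contraLR => jN.
  rewrite (tight _ jN) mulr0 addr0.
  by move: jN; rewrite inE.
exists k; rewrite inE// mulA divfK ?gt_eqF//.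
by rewrite addrC subrK ltxx.
Qed.

Lemma polyhedron_extreme_points (C : set 'cV[R]_n) :
    bounded_set polyhedron -> @convex_set R 'cV[R]_n C ->
    extreme_points polyhedron `<=` C ->
  polyhedron `<=` C.
Proof.
move=> bP /convex_setP cC eC x.
have [N] := ubnP #|slack x|; elim: N x => // N IHN x xN Px.
have [/eC//|nx] := pselect (extreme_points polyhedron x).
have [u [v [t [Pu Pv /andP[t0 t1] xE uv]]]] : exists u v t,
    [/\ polyhedron u, polyhedron v, 0 < t < 1, x = t *: u + (1 - t) *: v
      & u != v].
  apply: contrapT => H; apply: nx; split=> // u v t Pu Pv t01 xE.
  have [uv|uv] := eqVneq u v; last by case: H; exists u, v, t.
  by move: xE; rewrite uv -scalerDl addrC subrK scale1r.
have d0 : u - v != 0 by rewrite subr_eq0.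
(* Both ends have value at most [c k 0] and their average with positive weights equals it, so both
   values equal it. *)
have tight k : k \notin slack x -> (A *m (u - v)) k 0 = 0.
  rewrite inE -leNgt xE mulmxDr -!scalemxAr mulmxBr.
  have := Pv k; have := Pu k; move: (A *m u) (A *m v) => a b.
  by rewrite !mxE; nra.
have xwalk d : d != 0 -> (forall k, k \notin slack x -> (A *m d) k 0 = 0) ->
    exists2 s, 0 < s & C (x + s *: d).
  move=> dn0 dt; have [s [s0 Ps sl]] := polyhedron_walk bP Px dn0 dt.
  by exists s => //; apply: IHN => //; exact: leq_trans sl _.
have [s s0 Cs] := xwalk _ d0 tight.
have [|k kS|r r0 Cr] := xwalk (- (u - v)); first by rewrite oppr_eq0.
  by rewrite mulmxN mxE tight// oppr0.
have sr : 0 < s + r by rewrite addr_gt0.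
(* The weights are inversely proportional to the step lengths, so that the opposite displacements
   cancel. *)
have -> : x = r / (s + r) *: (x + s *: (u - v))
    + (1 - r / (s + r)) *: (x + r *: - (u - v)).
  move: (u - v) => d; apply/matrixP => i j; rewrite !mxE; field.
  by rewrite gt_eqF.
apply: cC => //; first by rewrite divr_ge0 ?ltW.
by rewrite ler_pdivrMr// mul1r lerDr ltW.
Qed.

End Polyhedron.

(** * The region between a convex function and its chord *)

Section Strip.
Context {R : realType}.
Variables (ylo yup : R) (g : R -> R).
Hypothesis hy : ylo < yup.
Hypothesis gconvex : @convex_function R R^o `[ylo, yup] g.

Let chord (t : R) := g ylo + (g yup - g ylo) / (yup - ylo) * (t - ylo).

Definition strip : set (R^o * R^o) :=
  [set e | [/\ ylo <= e.1 <= yup, g e.1 <= e.2 & e.2 <= chord e.1]].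

Lemma convex_functionP (s t a : R) : 0 <= a -> a <= 1 ->
    ylo <= s <= yup -> ylo <= t <= yup ->
  g (a * s + (1 - a) * t) <= a * g s + (1 - a) * g t.
Proof.
move=> a0 a1 hs ht.
by have := gconvex (Itv01 a0 a1) (x := s) (y := t); rewrite !inE /= !in_itv/=; apply.
Qed.

Let chord_weight (t : R) : ylo <= t <= yup ->
  exists a, [/\ 0 <= a, a <= 1, t = a * yup + (1 - a) * ylo
              & chord t = a * g yup + (1 - a) * g ylo].
Proof.
move=> /andP[lt tu]; have D : 0 < yup - ylo by rewrite subr_gt0.
exists ((t - ylo) / (yup - ylo)); split.
- by rewrite divr_ge0 ?subr_ge0// ltW.
- by rewrite ler_pdivrMr// mul1r lerD2r.
- by field; rewrite gt_eqF.
- by rewrite /chord; field; rewrite gt_eqF.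
Qed.

Lemma graph_sub_strip (t : R) : ylo <= t <= yup -> strip (t, g t).
Proof.
move=> ht; split=> //=; have [a [a0 a1 {2}-> ->]] := chord_weight ht.
by apply: convex_functionP; rewrite // ?lexx ltW.
Qed.

(** The lower bound is a convex function and the upper bound an affine one. *)
Lemma strip_convex : @convex_set R (R^o * R^o)%type strip.
Proof.
apply/convex_setP => -[s w] [t u] a a0 a1 [/= hs sw ws] [/= ht tu ut].
have b0 : 0 <= 1 - a by rewrite subr_ge0.
split=> /=; rewrite /GRing.scale /=.
- by case/andP: hs; case/andP: ht; nra.
- apply: le_trans (convex_functionP a0 a1 hs ht) _.
  by apply: lerD; exact: ler_wpM2l.
- have -> : chord (a * s + (1 - a) * t) = a * chord s + (1 - a) * chord t.
    by rewrite /chord; ring.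
  by apply: lerD; exact: ler_wpM2l.
Qed.

(* A point of the strip lies on the vertical segment between the graph and the
   chord, and the chord joins two points of the graph. *)
Lemma strip_sub_hull (C : set (R^o * R^o)) :
    @convex_set R (R^o * R^o)%type C ->
    (forall t : R, ylo <= t <= yup -> C (t, g t)) ->
  strip `<=` C.
Proof.
move=> /convex_setP cC gC [t w] [/= ht gw wc].
have Cchord : C (t, chord t).
  have [a [a0 a1 tE ->]] := chord_weight ht.
  rewrite [X in C (X, _)]tE.
  by apply: (cC (yup, g yup) (ylo, g ylo)) => //; apply: gC; rewrite lexx ltW.
(* If graph and chord meet over [t], the vertical segment is one point and the weight [a] below
   would divide by zero. *)
have [e|e] := eqVneq (chord t) (g t).
  suff -> : w = g t by exact: gC.
  by apply/eqP; rewrite eq_le gw -e wc.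
have D : 0 < chord t - g t by rewrite subr_gt0 lt_neqAle eq_sym e (le_trans gw wc).
pose a := (w - g t) / (chord t - g t).
have -> : (t, w) = a *: (t, chord t) + (1 - a) *: (t, g t) :> R^o * R^o.
  congr (_, _); first by rewrite /= -scalerDl addrC subrK scale1r.
  change (w = a * chord t + (1 - a) * g t); rewrite /a; field.
  by rewrite gt_eqF.
apply: cC => //; last exact: gC.
- by rewrite divr_ge0 ?subr_ge0// (le_trans gw).
- by rewrite ler_pdivrMr// mul1r lerD2r.
Qed.

(** For [l > 0], divide [y] and [w] by [l]. For [l = 0] the bounds force [y = w = 0], and any point
    of the strip is a witness, here [(ylo, g ylo)]. *)
Lemma gstar_le_chordP (l y w : R) : 0 <= l ->
  [/\ (gstar ylo yup g l y <= w%:E)%E,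
      w <= l * g ylo + (g yup - g ylo) / (yup - ylo) * (y - l * ylo)
    & l * ylo <= y <= l * yup]
  <-> exists2 e, strip e & y = l * e.1 /\ w = l * e.2.
Proof.
rewrite /gstar le_eqVlt => /predU1P[<-|l0].
  rewrite ltxx eqxx !mul0r /= subr0 add0r; split.
    move=> [+ wle /andP[y0 y0']].
    have y00 : y = 0 by apply/eqP; rewrite eq_le y0 y0'.
    move: wle; rewrite y00 eqxx lee_fin mulr0 => w0 w0'.
    exists (ylo, g ylo); first by apply: graph_sub_strip; rewrite lexx ltW.
    by rewrite !mul0r; split=> //; apply/eqP; rewrite eq_le w0.
  move=> [e _]; rewrite !mul0r => -[-> ->].
  by rewrite eqxx mulr0 !lexx.
have ln0 : l != 0 by rewrite gt_eqF.
have chordl t : l * g ylo + (g yup - g ylo) / (yup - ylo) * (l * t - l * ylo)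
    = l * chord t by rewrite /chord; ring.
rewrite l0 (negbTE ln0) /=; split.
  rewrite -(mulVKf ln0 y); move: (l^-1 * y) => t.
  rewrite -(mulVKf ln0 w); move: (l^-1 * w) => u.
  rewrite mulKf// chordl in_itv/= !ler_pM2l// => -[+ uc ht].
  by rewrite ht lee_fin ler_pM2l// => gu; exists (t, u).
move=> [[t u] [/= ht gu uc] [-> ->]].
by rewrite in_itv/= mulKf// ht chordl lee_fin !ler_pM2l.
Qed.

End Strip.

(** * Lifting the strip over each vertex *)

Section Lifting.
Context {R : realType} {n : nat}.

Definition lift_point (x : 'cV[R]_n) (e : R^o * R^o) : pi_space R n :=
  (x, e.1, e.2 *: x, e.1 *: x).

(** The products are bilinear in [x] and [e], but become linear in [e] once [x] is fixed. *)
Lemma lift_point_affine x (e e' : R^o * R^o) t :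
  lift_point x (t *: e + (1 - t) *: e')
  = t *: lift_point x e + (1 - t) *: lift_point x e'.
Proof.
case: e e' => [s w] [s' w']; congr (_, _, _, _).
- by rewrite /= -scalerDl addrC subrK scale1r.
- by rewrite /= !scalerA -scalerDl.
- by rewrite /= !scalerA -scalerDl.
Qed.

Lemma lift_point_image_convex x (A : set (R^o * R^o)) :
  @convex_set R (R^o * R^o)%type A ->
  @convex_set R (pi_space R n) (lift_point x @` A).
Proof.
move=> /convex_setP cA; apply/convex_setP => _ _ t t0 t1 [e Ae <-] [e' Ae' <-].
by rewrite -lift_point_affine; exists (t *: e + (1 - t) *: e') => //; exact: cA.
Qed.

Lemma lift_point_preimage_convex x (C : set (pi_space R n)) :
  @convex_set R (pi_space R n) C ->
  @convex_set R (R^o * R^o)%type (lift_point x @^-1` C).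
Proof.
move=> /convex_setP cC; apply/convex_setP => e e' t t0 t1 Ce Ce'.
by rewrite /= lift_point_affine; exact: cC.
Qed.

Lemma sum_lift_point m (v : 'I_m -> 'cV[R]_n) (l s w : 'I_m -> R) :
  \sum_i l i *: lift_point (v i) (s i, w i)
  = (\sum_i l i *: v i, \sum_i l i * s i, \sum_i (l i * w i) *: v i,
     \sum_i (l i * s i) *: v i).
Proof.
elim: m v l s w => [|m IHm] v l s w; first by rewrite !big_ord0.
by rewrite !big_ord_recl IHm -!scalerA.
Qed.

(** The inequalities decouple over [i], so [gstar_le_chordP] applies index by index; the linear
    equations then sum the lifted points. *)
Lemma projection_lifted_set m (v : 'I_m -> 'cV[R]_n) (ylo yup : R) (g : R -> R) :
    ylo < yup -> @convex_function R R^o `[ylo, yup] g ->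
  fst @` lifted_set v ylo yup g
  = convex_join (fun i => lift_point (v i) @` strip ylo yup g).
Proof.
move=> hy gc; apply/seteqP; split=> pi.
  move=> [[[[[x y] z] xy] [[[yi wi] w] l]] /=].
  move=> [[h1 h2 h3] [[-> -> _] [-> -> sl]]] <-.
  have l0 i : 0 <= l i by case: sl.
  have /choice[e eP] i : exists e, [/\ strip ylo yup g e, yi i = l i * e.1
      & wi i = l i * e.2].
    have [|e Se [ye we]] := (gstar_le_chordP hy gc (yi i) (wi i) (l0 i)).1.
      by split; [exact: h1|exact: h2|exact: h3].
    by exists e.
  exists l, (fun i => lift_point (v i) ((e i).1, (e i).2)); split=> //.
    by move=> i; have [Se _ _] := eP i; exists (e i) => //; rewrite -surjective_pairing.
  rewrite sum_lift_point; congr (_, _, _, _); apply: eq_bigr => i _;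
    by have [_ ye we] := eP i; rewrite ?ye ?we.
move=> [l [q [sl qP ->]]].
have /choice[e eP] i : exists e, strip ylo yup g e /\ lift_point (v i) e = q i.
  by have [e Se eE] := qP i; exists e.
have l0 i : 0 <= l i by case: sl.
have hP i := (gstar_le_chordP hy gc (l i * (e i).1) (l i * (e i).2) (l0 i)).2.
have {}hP i := hP i (ex_intro2 _ _ (e i) (eP i).1 (conj erefl erefl)).
exists (\sum_i l i *: q i, (fun i => l i * (e i).1, fun i => l i * (e i).2,
  \sum_i l i * (e i).2, l)) => //.
rewrite (eq_bigr (fun i => l i *: lift_point (v i) ((e i).1, (e i).2))); last first.
  by move=> i _; have [_ <-] := eP i.
rewrite sum_lift_point; split; last by [].
by split=> i; case: (hP i).
Qed.

End Lifting.

(** * Vertices of the polytope and the hull of [setS] *)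

Lemma bounded_nonneg_polyhedron_vertices (R : realType) (p n m : nat)
    (B : 'M[R]_(p, n)) (b : 'cV[R]_p) (v : 'I_m -> 'cV[R]_n) (x : 'cV[R]_n) :
    bounded_set (nonneg_polyhedron B b) ->
    range v = extreme_points (nonneg_polyhedron B b) ->
    nonneg_polyhedron B b x ->
  exists2 l, simplex l & x = \sum_i l i *: v i.
Proof.
(* The sign conditions become the rows of minus the identity. *)
have -> : nonneg_polyhedron B b = polyhedron (col_mx (- 1%:M) B) (col_mx 0 b).
  apply/seteqP; split=> u; rewrite /polyhedron /nonneg_polyhedron /= mul_col_mx.
    move=> [u0 ub] k; case: (split_ordP k) => j ->; rewrite ?col_mxEu ?col_mxEd//.
    by rewrite mulNmx mul1mx !mxE oppr_le0.
  move=> uP; split=> j.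
    have := uP (lshift _ j); rewrite !col_mxEu mulNmx mul1mx !mxE.
    by rewrite oppr_le0.
  by have := uP (rshift _ j); rewrite !col_mxEd.
move=> bP ext Px.
(* The join of the singletons is convex and contains each [v i] through a unit weight vector. *)
suff : convex_join (fun i => [set v i]) x.
  move=> [l [q [sl qv ->]]]; exists l => //.
  by apply: eq_bigr => i _; rewrite (qv i).
apply: polyhedron_extreme_points Px => //.
  by apply: convex_join_convex => i; exact: convex_set1.
rewrite -ext => _ [i _ <-].
exists (fun j => (j == i)%:R), v; split=> //.
  split=> [j|]; first exact: ler0n.
  by rewrite (bigD1 i)//= eqxx big1 ?addr0// => j /negbTE->.
rewrite (bigD1 i)//= eqxx scale1r big1 ?addr0// => j /negbTE->.
by rewrite scale0r.
Qed.

Theorem proposition9 (R : realType) (p n m : nat)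
    (B : 'M[R]_(p, n)) (b : 'cV[R]_p) (X : set 'cV[R]_n)
    (hX : X = nonneg_polyhedron B b) (hXbounded : bounded_set X)
    (v : 'I_m -> 'cV[R]_n) (hvinj : injective v)
    (hv : range v = extreme_points X)
    (ylo yup : R) (hy : ylo < yup) (g : R -> R)
    (hgcont : {within `[ylo, yup], continuous g})
    (hgconvex : @convex_function R R^o `[ylo, yup] g) :
  Conv (setS X ylo yup g) = fst @` lifted_set v ylo yup g.
Proof.
subst X.
rewrite (projection_lifted_set v hy hgconvex); apply/seteqP; split=> pi.
  apply; first apply: convex_join_convex => i.
    by apply: lift_point_image_convex; exact: strip_convex.
  move=> [[[x y] z] xy] [[[[/= Xx hyy] _] _]] S.
  have [l sl xE] : exists2 l, simplex l & x = \sum_i l i *: v i.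
    exact: bounded_nonneg_polyhedron_vertices hXbounded hv Xx.
  (* The same strip point [(y, g y)] is used over every vertex, so [y] and [g y] factor out of the
     sums and leave multiples of [x]. *)
  exists l, (fun i => lift_point (v i) (y, g y)); split=> // [i|].
    by exists (y, g y) => //; apply: graph_sub_strip; rewrite // -in_itv.
  rewrite sum_lift_point -xE -mulr_suml sl.2 mul1r.
  congr (_, _, _, _).
    transitivity (g y *: x).
      by apply/matrixP => j k; rewrite !ord1 mxE (S j).1 mulrC.
    rewrite xE scaler_sumr; apply: eq_bigr => i _.
    by rewrite scalerA mulrC.
  transitivity (y *: x).
    by apply/matrixP => j k; rewrite !ord1 mxE (S j).2 mulrC.
  rewrite xE scaler_sumr; apply: eq_bigr => i _.
  by rewrite scalerA mulrC.
move=> [l [q [sl qQ ->]]] C cC SC; apply: convex_combination => // i.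
have [e Se <-] := qQ i.
(* The preimage of [C] is convex and contains the graph, because [v i] lies in the polytope and [C]
   contains [setS]; hence it contains the strip. *)
have := @strip_sub_hull _ _ _ _ hy (lift_point (v i) @^-1` C).
apply; [exact: lift_point_preimage_convex| |exact: Se].
move=> t ht; apply: SC; split.
  split=> //; split=> //; split; last by rewrite /= in_itv.
  by have [] : extreme_points (nonneg_polyhedron B b) (v i) by rewrite -hv; exists i.
by move=> j; rewrite !mxE; split; rewrite mulrC.
Qed.
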